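(* On each of the following six finite domains of target pairs, $\mathrm{FWC}=\mathrm{EC}=L$ (i.e. a pair in the domain belongs to one of the three classes if and only if it belongs to the others): the dominated domains $\mathcal P(5,3)$, $\mathcal P(6,3)$, $\mathcal P(4,4)$ and the filtered domains $\mathcal P^{\mathrm{f}}(5,3)$, $\mathcal P^{\mathrm{f}}(6,3)$, $\mathcal P^{\mathrm{f}}(4,4)$.
   Context: A target pair $(H_w,H_r)$ consists of strictly increasing concave rational sequences $H_\alpha$ on $\{0,\dots,b_\alpha\}$, $\alpha\in\{w,r\}$, with $H_\alpha(0)=0$ (the zero sequence, $b_\alpha=0$, is allowed). $h_n=H_w(n)-H_w(n-1)$, $\rho_m=H_r(m)-H_r(m-1)$, $\rho_1:=0$ if $b_r=0$; $\bar H_\alpha(k)=H_\alpha(\min\{k,b_\alpha\})$. A positive count $n\le b_\alpha$ is an $\alpha$-vertex if $n=b_\alpha$ or the slopes of $H_\alpha$ immediately before and after $n$ differ; $\mathcal V_\alpha$ is the set of $\alpha$-vertices and $N^*=\sum_{n\in\mathcal V_w}n+\sum_{m\in\mathcal V_r}m$. Dominance means $H_r(k)\le\bar H_w(k)$ for $0\le k\le b_r$. Domains. $\mathcal P(B,M)$ is the set of target pairs with $b_w=3$, $0\le b_r\le M$, all slopes $h_n,\rho_m$ (nonincreasing) positive integers at most $B$, and satisfying dominance. $\mathcal P^{\mathrm f}(B,M)$ is the set of pairs in $\mathcal P(B,M)$ with $b_r\ge1$ such that: at each $w$-vertex $n$ with $H_w(n)>(n-1)H_w(1)+\rho_1$ one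 has $\bar H_w(n-1+m)\ge\frac{n-1}{n}H_w(n)+H_r(m)$ for $0\le m\le b_r$; and, if $H_w$ is linear with $H_w(1)=\rho_1$ and $\bar H_r(2)<2\rho_1$, then $H_r(b_r)\le2\rho_1$. Linear closure $L$: the set of target pairs satisfying dominance and, for all $0\le m\le b_r$: at each $w$-vertex $n$ with $h_n>\rho_1$, $\bar H_w(n-1+m)\ge\frac{n-1}{n}H_w(n)+H_r(m)$ and, if $n\ge3$, $\bar H_w(m+1)\ge\frac1nH_w(n)+H_r(m)$; and at each $w$-vertex $n\ge3$ with $\bar H_r(2)<H_w(n)-(n-2)H_w(1)$, $\bar H_w(m+1)\ge H_r(m)+\min\{H_w(n)/n,(H_w(n)-\rho_1)/(n-1)\}$. $\mathrm{EC}$ (exchange closure): the set of target pairs for which dominance holds and there is an admissible witness, consisting of: for each $w$-vertex $n$, an $n$-element labeled set $X_n$ with rational values $x_{n,i}$, a long/short label for each member, and a downward-closed family $\mathcal F_n$ of subsets of $X_n$ containing $\varnothing$ and whose singletons are precisely the short members; for each $r$-vertex $m$, an $m$-element set $Z_m$ with rational values $z_{m,j}$; for each such $(n,m)$, a subset $O_{n,m}\subseteq X_n$ with $O_{n,m}\in\mathcal F_n$ and a map $\pi_{n,m}:O_{n,m}\to Z_m$; such that: (EC1) $0\le x_{n,i}\le H_w(1)$, short values are at most $\rho_1$, $\sum_i x_{n,i}=H_w(n)$; every $S\subseteq X_n$ has total value at most $\bar H_w(|S|)$, and every $S\in\mathcal F_n$ has total value at most $\bar H_r(|S|)$. (EC2)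 $0\le z_{m,j}\le\rho_1$, $\sum_j z_{m,j}=H_r(m)$, and every $S\subseteq Z_m$ has total value at most $\bar H_r(|S|)$. (EC3) $\pi_{n,m}$ is injective, $O_{n,m}$ contains only short members, and $x_{n,i}=z_{m,\pi_{n,m}(i)}$ for $i\in O_{n,m}$. (EC4) For every $(n,m)$ and every long $i\in X_n$, with $k=|O_{n,m}|$, $\bar H_w(n-1+m-k)\ge H_w(n)-x_{n,i}+H_r(m)-\sum_{i'\in O_{n,m}}z_{m,\pi_{n,m}(i')}$. (EC5) For every $(n,m)$, every two-element subset $\{i,i'\}\subseteq X_n$ with $\{i,i'\}\notin\mathcal F_n$, and every $y\in X_n\setminus(\{i,i'\}\cup O_{n,m})$, $\bar H_w(m+1)\ge x_{n,y}+H_r(m)$. If $b_r=0$ the conditions quantifying over $m$ are vacuous. $\mathrm{FWC}$ (full-witness closure): write $G(S)=\sum_{i\in S}a_i$, $d(S)=\sum_{i\in S}d_i$. $\mathrm{FWC}$ is the set of target pairs possessing a full witness, i.e. a ground set $E$ of at most $N^*$ items, nonnegative rational values $a_i$, positive rational sizes $d_i$, rational $0\le R<D$, and subsets $X_n$ ($n\in\mathcal V_w$), $Z_m$ ($m\in\mathcal V_r$) of $E$ with $|X_n|=n$, $G(X_n)=H_w(n)$, $d(X_n)\le D$, $|Z_m|=m$, $G(Z_m)=H_r(m)$, $d(Z_m)\le R$, such that every $S\subseteq E$ with $d(S)\le D$ has $G(S)\le\bar H_w(|S|)$ and every $S\subseteq E$ with $d(S)\le R$ has $G(S)\le\bar H_r(|S|)$.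 *)

(* Defs.v *)
From mathcomp Require Import all_boot all_order all_algebra.

Set Implicit Arguments.
Unset Strict Implicit.
Unset Printing Implicit Defensive.

Import Order.TTheory GRing.Theory Num.Theory.

Local Open Scope ring_scope.

Record target_seq := TargetSeq {
  len : nat;
  tval : {ffun 'I_len.+1 -> rat};
  tval0 : tval ord0 = 0;
  tval_incr : forall i j : 'I_len.+1, (i < j)%N -> tval i < tval j;
  tval_concave : forall i j k : 'I_len.+1, j = i.+1 :> nat -> k = j.+1 :> nat ->
    tval k - tval j <= tval j - tval i }.

(* The extension k |-> H (min k b) of H to all of nat. Since it agrees with H on
   {0, ..., b}, the coercion lets [H k] denote both H(k) and \bar H(k). *)
Definition ext (H : target_seq) (k : nat) : rat := tval H (inord (minn k (len H))).
Coercion ext : target_seq >-> Funclass.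

(* Meaningful for 1 <= n <= len H. *)
Definition slope (H : target_seq) (n : nat) : rat := H n - H n.-1.

(* When len Hr = 0 this is 0, as Hr 1 = Hr 0. *)
Definition rho1 (Hr : target_seq) : rat := slope Hr 1.

Definition vertex (H : target_seq) (n : nat) : bool :=
  (0 < n <= len H)%N && ((n == len H) || (slope H n != slope H n.+1)).

Definition Nstar (Hw Hr : target_seq) : nat :=
  (\sum_(n < (len Hw).+1 | vertex Hw n) n + \sum_(m < (len Hr).+1 | vertex Hr m) m)%N.

Definition dominance (Hw Hr : target_seq) : Prop :=
  forall k, (k <= len Hr)%N -> Hr k <= Hw k.

Definition slopes_in (B : nat) (H : target_seq) : Prop :=
  forall n, (0 < n <= len H)%N -> exists2 j : nat, (0 < j <= B)%N & slope H n = j%:R.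

Definition dom (B M : nat) (Hw Hr : target_seq) : Prop :=
  [/\ len Hw = 3%N, (len Hr <= M)%N, slopes_in B Hw, slopes_in B Hr
    & dominance Hw Hr].

Definition linear_seq (H : target_seq) : Prop :=
  forall n, (n <= len H)%N -> H n = n%:R * H 1%N.

Definition fdom (B M : nat) (Hw Hr : target_seq) : Prop :=
  [/\ dom B M Hw Hr, (1 <= len Hr)%N,
      forall n, vertex Hw n -> (n.-1)%:R * Hw 1%N + rho1 Hr < Hw n ->
        forall m, (m <= len Hr)%N ->
          (n.-1)%:R / n%:R * Hw n + Hr m <= Hw (n.-1 + m)%N
    & linear_seq Hw -> Hw 1%N = rho1 Hr -> Hr 2%N < 2%:R * rho1 Hr ->
        Hr (len Hr) <= 2%:R * rho1 Hr].

Definition linear_closure (Hw Hr : target_seq) : Prop :=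
  dominance Hw Hr /\
  forall m, (m <= len Hr)%N ->
    (forall n, vertex Hw n -> rho1 Hr < slope Hw n ->
       (n.-1)%:R / n%:R * Hw n + Hr m <= Hw (n.-1 + m)%N /\
       ((3 <= n)%N -> n%:R^-1 * Hw n + Hr m <= Hw m.+1)) /\
    (forall n, vertex Hw n -> (3 <= n)%N ->
       Hr 2%N < Hw n - (n - 2)%:R * Hw 1%N ->
       Hr m + Num.min (Hw n / n%:R) ((Hw n - rho1 Hr) / (n.-1)%:R) <= Hw m.+1).

(* The sets X_n and Z_m are indexed by 'I_n and 'I_m. The data is given for all
   n and m, but the admissibility conditions constrain it at vertices only.
   The long members of X_n are those outside [xshort n]. *)
Record exchange_data := ExchangeData {
  xval : forall n, 'I_n -> rat;
  xshort : forall n, {set 'I_n};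
  fam : forall n, {set {set 'I_n}};
  zval : forall m, 'I_m -> rat;
  ovl : forall n m : nat, {set 'I_n};
  proj : forall n m, {i : 'I_n | i \in ovl n m} -> 'I_m }.

Section Admissible.
Variables (Hw Hr : target_seq) (W : exchange_data).

Definition family_ok (n : nat) : Prop :=
  [/\ set0 \in fam W n,
      forall S T : {set 'I_n}, S \subset T -> T \in fam W n -> S \in fam W n
    & forall i : 'I_n, ([set i] \in fam W n) = (i \in xshort W n)].

Definition EC1 (n : nat) : Prop :=
  [/\ forall i : 'I_n, 0 <= xval W i <= Hw 1%N,
      forall i : 'I_n, i \in xshort W n -> xval W i <= rho1 Hr,
      \sum_(i < n) xval W i = Hw n,
      forall S : {set 'I_n}, \sum_(i in S) xval W i <= Hw #|S|
    & forall S : {set 'I_n}, S \in fam W n -> \sum_(i in S) xval W i <= Hr #|S| ].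

Definition EC2 (m : nat) : Prop :=
  [/\ forall j : 'I_m, 0 <= zval W j <= rho1 Hr,
      \sum_(j < m) zval W j = Hr m
    & forall S : {set 'I_m}, \sum_(j in S) zval W j <= Hr #|S| ].

Definition EC3 (n m : nat) : Prop :=
  [/\ injective (@proj W n m),
      ovl W n m \subset xshort W n
    & forall u : {i : 'I_n | i \in ovl W n m}, xval W (sval u) = zval W (proj u)].

(* No truncation occurs in n.-1 + m - k: k <= n.-1 as i is not in the overlap. *)
Definition EC4 (n m : nat) : Prop :=
  forall i : 'I_n, i \notin xshort W n ->
    let k := #|ovl W n m| in
    Hw n - xval W i + Hr m
      - \sum_(u : {i : 'I_n | i \in ovl W n m}) zval W (proj u)
    <= Hw (n.-1 + m - k)%N.

Definition EC5 (n m : nat) : Prop :=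
  forall i i' : 'I_n, i != i' -> [set i; i'] \notin fam W n ->
  forall y : 'I_n, y \notin [set i; i'] :|: ovl W n m ->
    xval W y + Hr m <= Hw m.+1.

Definition admissible : Prop :=
  [/\ forall n, vertex Hw n -> family_ok n /\ EC1 n,
      forall m, vertex Hr m -> EC2 m
    & forall n m, vertex Hw n -> vertex Hr m ->
        [/\ ovl W n m \in fam W n, EC3 n m, EC4 n m & EC5 n m]].

End Admissible.

Definition exchange_closure (Hw Hr : target_seq) : Prop :=
  dominance Hw Hr /\ exists W : exchange_data, admissible Hw Hr W.

Definition total (E : finType) (f : E -> rat) (S : {set E}) : rat :=
  \sum_(i in S) f i.

Record full_witness_data := FullWitnessData {
  ground : finType;
  gain : ground -> rat;
  dsize : ground -> rat;
  capR : rat;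
  capD : rat;
  Xset : nat -> {set ground};
  Zset : nat -> {set ground} }.

Definition full_witness (Hw Hr : target_seq) (W : full_witness_data) : Prop :=
  let G := total (@gain W) in
  let d := total (@dsize W) in
  [/\ [/\ (#|ground W| <= Nstar Hw Hr)%N,
          forall i : ground W, 0 <= gain i,
          forall i : ground W, 0 < dsize i
        & 0 <= capR W < capD W],
      forall n, vertex Hw n ->
        [/\ #|Xset W n| = n, G (Xset W n) = Hw n & d (Xset W n) <= capD W],
      forall m, vertex Hr m ->
        [/\ #|Zset W m| = m, G (Zset W m) = Hr m & d (Zset W m) <= capR W],
      forall S : {set ground W}, d S <= capD W -> G S <= Hw #|S|
    & forall S : {set ground W}, d S <= capR W -> G S <= Hr #|S| ].

Definition full_witness_closure (Hw Hr : target_seq) : Prop :=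
  exists W : full_witness_data, full_witness Hw Hr W.

Definition classes_agree_on (D : target_seq -> target_seq -> Prop) : Prop :=
  forall Hw Hr : target_seq, D Hw Hr ->
    (full_witness_closure Hw Hr <-> exchange_closure Hw Hr) /\
    (exchange_closure Hw Hr <-> linear_closure Hw Hr).

(* Main.v *)
From Pilot Require Import Defs.
From mathcomp Require Import all_boot all_order all_algebra.
From mathcomp Require Import ring lra.

(** The implications FWC => EC => L hold for every target pair; the finite domains
    enter in L => FWC.

    FWC => EC ([full_to_exchange]). The sets of a full witness are themselves an
    exchange witness: an item is short when its size is at most R, a family is
    feasible when its total size is at most R, and the overlap is the
    intersection of X_n with Z_m. The exchange inequalities are the bound by Hw
    on sets that fit D because R < d(i) for a long i, and R < d(i) + d(i') for
    an infeasible pair: in X_n such members can be replaced by all of Z_m.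

    EC => L ([exchange_to_linear]). Averaging the exchange inequalities over the
    members of X_n that they apply to removes the individual values. If
    h_n > rho_1 then every member of X_n is worth at least h_n, so all are long
    and the overlap is empty. If Hr 2 < Hw n - (n - 2) Hw 1 then any two members
    of X_n are worth more than Hr 2, so no pair is feasible and the overlap has
    at most one element; the two terms of the minimum in L correspond to the
    overlap having zero elements and one. This gives L at the vertices m of Hr,
    and concavity of Hw extends it to all m ([concave_majorant]).

    L => FWC ([linear_to_full]). Slopes in the domains are positive integers, so
    a pair is given by two lists of slopes, and L amounts to finitely many
    integer inequalities on them. For each of the finitely many pairs that
    satisfy these, one of seven candidate witnesses passes an exhaustive test of
    all sets of items that fit. Five of the candidates are instances of one
    construction ([layered]), which covers all pairs but two. *)

Set Implicit Arguments.
Unset Strict Implicit.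
Unset Printing Implicit Defensive.

(* The name total must denote the sum of the definitions, not the order
   property of the same name. *)
Import Pilot.Defs.
Import Order.TTheory GRing.Theory Num.Theory.

Local Open Scope ring_scope.

(** * Concave sequences *)

Section Sequences.
Implicit Types H : target_seq.

Lemma ext0 H : H 0%N = 0.
Proof.
rewrite /ext min0n -(tval0 H); congr (Defs.tval H _).
by apply/val_inj; rewrite /= inordK.
Qed.

Lemma ext_incr H k : (k < len H)%N -> H k < H k.+1.
Proof.
move=> ltk; rewrite /ext (minn_idPl ltk) (minn_idPl (ltnW ltk)).
by apply: tval_incr; rewrite !inordK // ltnW.
Qed.

Lemma ext_const H k : (len H <= k)%N -> H k.+1 = H k.
Proof. by move=> lek; rewrite /ext !(minn_idPr _) // leqW. Qed.

Lemma ext_leS H k : H k <= H k.+1.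
Proof.
by case: (ltnP k (len H)) => [/ext_incr/ltW|/ext_const ->].
Qed.

Lemma ext_concave H k : H k.+2 - H k.+1 <= H k.+1 - H k.
Proof.
case: (ltnP k.+1 (len H)) => [ltk|/ext_const ->]; last first.
  by rewrite subrr subr_ge0 ext_leS.
have [lek1 lek] := (ltnW ltk, ltnW (ltnW ltk)).
rewrite /ext (minn_idPl ltk) (minn_idPl lek1) (minn_idPl lek).
by apply: tval_concave; rewrite !inordK.
Qed.

Lemma ext_concave_shift H d k : H (d + k.+1)%N - H (d + k)%N <= H k.+1 - H k.
Proof.
elim: d => [//|d IH]; apply: le_trans IH.
by rewrite !addSn !addnS; apply: ext_concave.
Qed.

Lemma slope_le_mean H n : n%:R * slope H n <= H n.
Proof.
elim: n => [|n IH]; first by rewrite mul0r ext0.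
suff: n%:R * slope H n.+1 <= n%:R * slope H n.
  have -> : H n.+1 = H n + slope H n.+1 by rewrite /slope /= addrC subrK.
  by rewrite -natr1 mulrDl mul1r; lra.
case: (n) => [|k]; first by rewrite !mul0r.
by apply: ler_wpM2l; rewrite ?ler0n // ext_concave.
Qed.

Lemma vertex_len H : (0 < len H)%N -> vertex H (len H).
Proof. by move=> b_gt0; rewrite /vertex b_gt0 leqnn eqxx. Qed.

Lemma nonvertex_slope H m : (0 < m <= len H)%N -> ~~ vertex H m ->
  (m < len H)%N /\ H m.+1 - H m = H m - H m.-1.
Proof.
move=> /andP[m_gt0 lem]; rewrite /vertex m_gt0 lem /= negb_or negbK.
by move=> /andP[neq /eqP]; rewrite ltn_neqAle neq lem /slope /= => ->.
Qed.

(** Between two vertices [H] is affine while [g] is concave. So once [H]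
    exceeds [g] somewhere, the gap widens at every later step up to and
    including the next vertex, where it was assumed absent. *)
Lemma concave_majorant H (g : nat -> rat) :
    (forall k, g k.+2 - g k.+1 <= g k.+1 - g k) ->
    0 <= g 0%N -> (forall m, vertex H m -> H m <= g m) ->
  forall m, (m <= len H)%N -> H m <= g m.
Proof.
move=> g_concave g0 gV m lem; rewrite leNgt; apply/negP => ltgm.
(* [m1] is the first place where H exceeds g, so the gap widens on arrival. *)
have [m1 lt1 min1] := ex_minnP (ex_intro (fun m => g m < H m) m ltgm).
have le1 := leq_trans (min1 _ ltgm) lem.
case: m1 => [|m1] in lt1 min1 le1 *; first by rewrite ext0 ltNge g0 in lt1.
have ge1 : H m1 <= g m1 by rewrite leNgt; apply/negP => /min1; rewrite ltnn.
suff loop d : (m1.+1 + d <= len H)%N ->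
    g (m1.+1 + d)%N < H (m1.+1 + d)%N /\
    g (m1 + d).+1 - g (m1 + d)%N < H (m1 + d).+1 - H (m1 + d)%N.
  have := loop (len H - m1.+1)%N; rewrite subnKC // => /(_ (leqnn _))[lt_b _].
  by have := gV _ (vertex_len (leq_trans (ltn0Sn _) le1)); rewrite leNgt lt_b.
elim: d => [|d IH] le_d; first by rewrite addn0 addn0; split=> //; lra.
rewrite addnS in le_d *; have [lt_d step_d] := IH (ltnW le_d).
have nv : ~~ vertex H (m1.+1 + d) by apply/negP => /gV; rewrite leNgt lt_d.
have [_] := @nonvertex_slope H (m1.+1 + d) (ltnW le_d) nv.
rewrite addSn addnS /= in lt_d le_d * => eqH.
by have := g_concave (m1 + d)%N; split; lra.
Qed.
End Sequences.

(** * From exchange witnesses to the linear inequalities *)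

Lemma concave_shift (H : target_seq) a (d : rat) k :
  let g m := H (a + m)%N - d in g k.+2 - g k.+1 <= g k.+1 - g k :> rat.
Proof. by move=> /=; rewrite !addnS; have := ext_concave H (a + k); lra. Qed.

(** The other n - 1 members together are worth at most Hw (n - 1). *)
Lemma member_ge_slope Hw Hr W n (i : 'I_n) :
  EC1 Hw Hr W n -> slope Hw n <= xval W i.
Proof.
case=> _ _ sumX /(_ [set~ i]) + _.
rewrite cardsC1 card_ord /slope -sumX [\sum_(i < n) _](bigD1 i) //=.
by rewrite (eq_bigl (fun j => j != i)) => [|j]; rewrite ?inE //; lra.
Qed.

Lemma sum_le_const n (P : pred 'I_n) (x : 'I_n -> rat) (c : rat) :
  (forall i, P i -> x i <= c) -> \sum_(i | P i) x i <= #|P|%:R * c.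
Proof.
by move=> le_c; rewrite mulr_natl -sumr_const; apply: ler_sum.
Qed.

Lemma sum_ord_le n (x : 'I_n -> rat) (c : rat) :
  (forall i, x i <= c) -> \sum_(i < n) x i <= n%:R * c.
Proof.
by move=> le_c; rewrite -[X in X%:R](card_ord n); apply: sum_le_const.
Qed.

Lemma two_others n (i : 'I_n) : (3 <= n)%N ->
  exists j k : 'I_n, [/\ j != k, j != i & k != i].
Proof.
move=> n3; have : (1 < #|[set~ i]|)%N.
  by rewrite cardsC1 card_ord; case: (n) n3 => [|[|[]]].
by case/card_gt1P => j [k []]; rewrite !inE => ji ki jk; exists j, k.
Qed.

Section ExchangeToLinear.
Variables (Hw Hr : target_seq) (W : exchange_data).
Hypothesis W_ok : admissible Hw Hr W.

(** All members of X_n are long here, so no overlap is possible and every pair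
    is infeasible: EC4 holds at every member, and EC5 at every member once a
    pair avoiding it exists, that is for n >= 3. Both are averaged over X_n. *)
Lemma long_vertex_gain n : vertex Hw n -> rho1 Hr < slope Hw n ->
  forall m, vertex Hr m ->
    n.-1%:R / n%:R * Hw n + Hr m <= Hw (n.-1 + m)%N /\
    ((3 <= n)%N -> n%:R^-1 * Hw n + Hr m <= Hw m.+1).
Proof.
case: W_ok => okX _ okXZ Vn long m Vm.
have [[F0 Fsub Fsing] ec1] := okX _ Vn.
have [OF [_ Oshort _] ec4 ec5] := okXZ _ _ Vn Vm.
have all_long i : i \notin xshort W n.
  have [_ shortX _ _ _] := ec1; apply/negP => /shortX.
  by have := member_ge_slope i ec1; lra.
have O0 : ovl W n m = set0.
  apply/eqP; rewrite -subset0; apply/subsetP => i /(subsetP Oshort).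
  by rewrite (negPf (all_long i)).
have n_gt0 : (0 < n)%N by case/andP: Vn => /andP[].
have nR : 0 < n%:R :> rat by rewrite ltr0n.
have [_ _ sumX _ _] := ec1.
split.
  have lb (i : 'I_n) : Hw n + Hr m - Hw (n.-1 + m)%N <= xval W i.
    have := ec4 i (all_long i); rewrite /= [#|_|](eq_card0 (A := ovl W n m)).
      rewrite subn0 big1 => [|[j j_ovl] _]; first by lra.
      by exfalso; move: j_ovl; rewrite O0 inE.
    by move=> j; rewrite O0 inE.
  have : \sum_(i < n) - xval W i
      <= n%:R * - (Hw n + Hr m - Hw (n.-1 + m)%N).
    by apply: sum_ord_le => i; rewrite lerN2.
  rewrite sumrN sumX mulrN lerN2 mulrC -ler_pdivlMr // => le_mean.
  have -> : n.-1%:R / n%:R = 1 - n%:R^-1 :> rat.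
    case: (n) n_gt0 => // n' _ /=; rewrite -[n'.+1%:R]natr1; field.
    by rewrite natr1 pnatr_eq0.
  by rewrite mulrBl mul1r [n%:R^-1 * _]mulrC; lra.
move=> n3.
have ub (i : 'I_n) : xval W i <= Hw m.+1 - Hr m.
  have [j [k [jk ji ki]]] := two_others i n3.
  have := @ec5 j k jk.
  have -> : [set j; k] \notin fam W n.
    apply/negP => /(Fsub [set j] _ (subsetUl _ _)).
    by rewrite Fsing (negPf (all_long j)).
  move=> /(_ isT i); rewrite O0 setU0 !inE (eq_sym i) (eq_sym i).
  by rewrite (negPf ji) (negPf ki) => /(_ isT); lra.
have := sum_ord_le ub; rewrite sumX -ler_pdivrMl //; lra.
Qed.

(** The other n - 2 members are worth at most Hw 1 each, so the hypothesis makes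
    every pair worth more than Hr 2, hence infeasible. Then EC5 bounds every
    member outside the overlap, which has at most one element, short and so
    worth at most rho_1. *)
Lemma unpaired_vertex_gain n : vertex Hw n -> (3 <= n)%N ->
    Hr 2%N < Hw n - (n - 2)%:R * Hw 1%N ->
  forall m, vertex Hr m ->
    Hr m + Num.min (Hw n / n%:R) ((Hw n - rho1 Hr) / n.-1%:R) <= Hw m.+1.
Proof.
case: W_ok => okX _ okXZ Vn n3 tight m Vm.
have [[F0 Fsub Fsing] ec1] := okX _ Vn.
have [OF [_ Oshort _] _ ec5] := okXZ _ _ Vn Vm.
have [xle shortX sumX _ subF] := ec1.
have nopair j k : j != k -> [set j; k] \notin fam W n.
  move=> jk; apply/negP => /subF; rewrite cards2 jk leNgt.
  suff: Hw n - (n - 2)%:R * Hw 1%N <= \sum_(i in [set j; k]) xval W i by lra.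
  rewrite -sumX (bigID (mem [set j; k])) /= lerBlDr lerD2l.
  have -> : (n - 2)%N = #|[pred i : 'I_n | i \notin [set j; k]]|.
    have := cardsCs (~: [set j; k]); rewrite setCK card_ord cards2 jk => <-.
    by apply: eq_card => i; rewrite !inE.
  by apply: sum_le_const => i _; case/andP: (xle i).
have leO : (#|ovl W n m| <= 1)%N.
  rewrite leqNgt; apply/card_gt1P => -[j [k [jO kO /nopair/negP]]]; apply.
  by apply: Fsub OF; apply/subsetP => i; rewrite !inE => /orP[] /eqP ->.
have ub (i : 'I_n) : i \notin ovl W n m -> xval W i <= Hw m.+1 - Hr m.
  move=> iO.
  have [j [k [jk ji ki]]] := two_others i n3.
  have := @ec5 j k jk.
  rewrite nopair // => /(_ isT i).
  rewrite !inE (eq_sym i) (eq_sym i) (negPf ji) (negPf ki) (negPf iO).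
  by move=> /(_ isT); lra.
suff: Num.min (Hw n / n%:R) ((Hw n - rho1 Hr) / n.-1%:R) <= Hw m.+1 - Hr m.
  by lra.
rewrite ge_min; apply/orP.
case: (posnP #|ovl W n m|) => [/cards0_eq O0|O_gt0].
  left; rewrite ler_pdivrMr ?ltr0n; last by case: (n) n3.
  by rewrite -sumX mulrC; apply: sum_ord_le => i; rewrite ub // O0 inE.
have /cards1P[o Oo] : #|ovl W n m| == 1%N by rewrite eqn_leq leO.
right; rewrite ler_pdivrMr ?ltr0n; last by case: (n) n3 => [|[]].
have xo : xval W o <= rho1 Hr.
  by apply: shortX; rewrite (subsetP Oshort) // Oo inE.
have le_rest : \sum_(i < n | i != o) xval W i <= n.-1%:R * (Hw m.+1 - Hr m).
  have -> : n.-1 = #|[pred i : 'I_n | i != o]|.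
    by rewrite -[in LHS](card_ord n) -(cardC1 o).
  by apply: sum_le_const => i io; rewrite ub // Oo inE.
by rewrite mulrC -sumX (bigD1 o) //=; lra.
Qed.

Lemma exchange_to_linear : dominance Hw Hr -> linear_closure Hw Hr.
Proof.
move=> domHH; split=> // m lem.
have avg0 n : (0 < n)%N -> n%:R^-1 * Hw n <= Hw 1%N.
  move=> n_gt0; rewrite ler_pdivrMl ?ltr0n //.
  elim: n {n_gt0} => [|n IH]; first by rewrite ext0 mul0r.
  rewrite -natr1 mulrDl mul1r.
  by have := ext_concave_shift Hw n 0; rewrite ext0 addn0 addn1; lra.
split=> n Vn.
  have n_gt0 : (0 < n)%N by case/andP: Vn => /andP[].
  move=> long; split=> [|n3].
    pose g k := Hw (n.-1 + k)%N - n.-1%:R / n%:R * Hw n.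
    suff: Hr m <= g m by rewrite /g; lra.
    apply: concave_majorant lem; first exact: concave_shift.
      rewrite /g addn0 subr_ge0 mulrAC ler_pdivrMr ?ltr0n //.
      have := slope_le_mean Hw n; rewrite /slope.
      by case: (n) n_gt0 => // k _ /=; rewrite -[k.+1%:R]natr1; lra.
    by move=> k Vk; rewrite /g; have [le_k _] := long_vertex_gain Vn long Vk; lra.
  pose g k := Hw (1 + k)%N - n%:R^-1 * Hw n.
  suff: Hr m <= g m by rewrite /g add1n; lra.
  apply: concave_majorant lem; first exact: concave_shift.
    by rewrite /g addn0 subr_ge0 avg0.
  move=> k Vk; rewrite /g add1n.
  by have [_ /(_ n3)] := long_vertex_gain Vn long Vk; lra.
move=> n3 tight; set c := Num.min _ _.
pose g k := Hw (1 + k)%N - c.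
suff: Hr m <= g m by rewrite /g add1n; lra.
apply: concave_majorant lem; first exact: concave_shift.
  rewrite /g addn0 subr_ge0 /c ge_min mulrC avg0 //.
  by case: (n) n3.
move=> k Vk; rewrite /g add1n.
by have := unpaired_vertex_gain Vn n3 tight Vk; rewrite -/c; lra.
Qed.

End ExchangeToLinear.

(** * From full witnesses to exchange witnesses *)

Section FullToExchange.
Variables (Hw Hr : target_seq) (W : full_witness_data).
Hypothesis W_ok : full_witness Hw Hr W.

Let G := total (@gain W).
Let d := total (@dsize W).

Lemma totalU (f : ground W -> rat) (S T : {set ground W}) :
  total f (S :|: T) + total f (S :&: T) = total f S + total f T.
Proof.
rewrite /total [X in X + _ = _](bigID (mem S)) [X in _ = _ + X](bigID (mem S)) /=.
rewrite (eq_bigl (mem S)) => [|i]; last first.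
  by rewrite !inE; case: (i \in S); rewrite ?orbT ?andbT ?andbF.
rewrite [X in _ + X + _](eq_bigl (fun i => (i \in T) && (i \notin S))) => [|i].
  rewrite [X in _ + _ + X](eq_bigl (fun i => (i \in T) && (i \in S))) => [|i].
    by rewrite -addrA [X in _ + X]addrC.
  by rewrite !inE andbC.
by rewrite !inE; case: (i \in S); rewrite ?andbF.
Qed.

Lemma dsizeS (S T : {set ground W}) : S \subset T -> d S <= d T.
Proof.
case: W_ok => -[_ _ d_gt0 _] _ _ _ _ /setIidPr ST.
rewrite /d /total -ST [X in _ <= X](big_setID S) /= lerDl.
by apply: sumr_ge0 => i _; rewrite ltW.
Qed.

Lemma full_dominance : dominance Hw Hr.
Proof.
case: W_ok => -[_ _ _ /andP[_ RD]] _ okZ boundD _ m.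
apply: concave_majorant; [exact: ext_concave | by rewrite ext0 |].
move=> k /okZ[cardZ <- dZ]; rewrite -[in X in _ <= X]cardZ.
exact/boundD/(le_trans dZ)/ltW.
Qed.

(* A default item makes the enumerations total. *)
Variable x0 : ground W.

Definition member n (i : 'I_n) : ground W := nth x0 (enum (Xset W n)) i.

(** The test on the cardinal of Z_m is true at every vertex m; with it the rank of
    a common element in Z_m is below m for all m, as the type of [proj] asks. *)
Definition overlap n m : {set 'I_n} :=
  [set i | (#|Zset W m| == m) && (member i \in Zset W m)].

Lemma overlap_rank n m (u : {i : 'I_n | i \in overlap n m}) :
  (index (member (sval u)) (enum (Zset W m)) < m)%N.
Proof.
case: u => i /=; rewrite inE => /andP[/eqP cardZ iZ].
by rewrite -[X in (_ < X)%N]cardZ cardE index_mem mem_enum.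
Qed.

Definition exchange_of : exchange_data := ExchangeData
  (fun n i => gain (@member n i))
  (fun n => [set i | dsize (@member n i) <= capR W])
  (fun n => [set S : {set 'I_n} | d (@member n @: S) <= capR W])
  (fun m (j : 'I_m) => gain (nth x0 (enum (Zset W m)) j))
  (fun n m u => Ordinal (overlap_rank (n := n) (m := m) u)).

Lemma member_in n (i : 'I_n) : vertex Hw n -> member i \in Xset W n.
Proof.
case: W_ok => _ okX _ _ _ /okX[cardX _ _].
by rewrite -mem_enum mem_nth // -cardE cardX.
Qed.

Lemma member_inj n : vertex Hw n -> injective (@member n).
Proof.
case: W_ok => _ okX _ _ _ /okX[cardX _ _] i j /eqP.
by rewrite nth_uniq ?enum_uniq -?cardE ?cardX // => /eqP/val_inj.
Qed.

Lemma total_member (f : ground W -> rat) n (S : {set 'I_n}) : vertex Hw n ->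
  total f (@member n @: S) = \sum_(i in S) f (member i).
Proof. by move=> /member_inj inj; rewrite /total big_imset //; apply: in2W. Qed.

Lemma member_im n : vertex Hw n -> @member n @: [set: 'I_n] = Xset W n.
Proof.
move=> Vn; apply/eqP; rewrite eqEcard; apply/andP; split.
  by apply/subsetP => _ /imsetP[i _ ->]; apply: member_in.
rewrite card_imset; last exact: member_inj.
by case: W_ok => _ /(_ _ Vn)[-> _ _] _ _ _; rewrite cardsT card_ord.
Qed.

Lemma member_sub n (S : {set 'I_n}) : vertex Hw n -> @member n @: S \subset Xset W n.
Proof. by move=> Vn; rewrite -(member_im Vn) imsetS. Qed.

Lemma exchange_X n : vertex Hw n ->
  family_ok exchange_of n /\ EC1 Hw Hr exchange_of n.
Proof.
move=> Vn; have inj := member_inj Vn.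
case: W_ok => -[_ gain_ge0 _ /andP[R0 RD]] /(_ _ Vn)[cardX GX dX] _ bD bR.
split; split=> //=.
- by rewrite inE imset0 /d /total big_set0.
- by move=> S T ST; rewrite !inE; apply: le_trans; rewrite dsizeS ?imsetS.
- by move=> i; rewrite !inE imset_set1 /d /total big_set1.
- move=> i; rewrite gain_ge0 /=.
  have := bD [set member i]; rewrite cards1 /total !big_set1; apply.
  have := dsizeS (S := [set member i]) (T := Xset W n).
  rewrite sub1set member_in // => /(_ isT); rewrite /d {1}/total big_set1.
  by move/le_trans; apply.
- move=> i; rewrite inE => di.
  have := bR [set member i].
  by rewrite cards1 /total !big_set1 /rho1 /slope ext0 subr0; apply.
- rewrite -GX -(member_im Vn) total_member //.
  by apply: eq_bigl => i; rewrite inE.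
- move=> S; rewrite -(total_member _ S Vn) -(card_imset _ inj).
  by apply: bD; apply: le_trans dX; rewrite dsizeS ?member_sub.
- move=> S; rewrite inE -(total_member _ S Vn) -(card_imset _ inj).
  exact: bR.
Qed.

Lemma exchange_Z m : vertex Hr m -> EC2 Hr exchange_of m.
Proof.
case: W_ok => -[_ gain_ge0 _ /andP[R0 RD]] _ okZ _ bR /okZ[cardZ GZ dZ].
pose e (j : 'I_m) := nth x0 (enum (Zset W m)) j.
have szZ : size (enum (Zset W m)) = m by rewrite -cardE.
have inj : injective e.
  by move=> i j /eqP; rewrite nth_uniq ?enum_uniq ?szZ // => /eqP/val_inj.
have inZ j : e j \in Zset W m by rewrite -mem_enum mem_nth ?szZ.
have subZ (S : {set 'I_m}) : e @: S \subset Zset W m.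
  by apply/subsetP => _ /imsetP[i _ ->].
have imT : e @: [set: 'I_m] = Zset W m.
  by apply/eqP; rewrite eqEcard subZ card_imset // cardsT card_ord cardZ /=.
have sumS (S : {set 'I_m}) : \sum_(j in S) gain (e j) <= Hr #|S|.
  rewrite -(card_imset _ inj) -(big_imset (fun x => gain x)); last exact: in2W.
  by apply: bR; apply: le_trans dZ; rewrite dsizeS.
split=> //=.
- move=> j; rewrite gain_ge0 /=.
  by have := sumS [set j]; rewrite cards1 big_set1 /rho1 /slope ext0 subr0.
- rewrite -GZ /total -[in RHS]imT big_imset /=; last exact: in2W.
  by apply: eq_bigl => j; rewrite inE.
Qed.

Lemma exchange_XZ n m : vertex Hw n -> vertex Hr m ->
  [/\ overlap n m \in fam exchange_of n, EC3 exchange_of n m,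
      EC4 Hw Hr exchange_of n m & EC5 Hw Hr exchange_of n m].
Proof.
move=> Vn Vm; have inj := member_inj Vn.
case: W_ok => -[_ gain_ge0 d_gt0 /andP[R0 RD]] /(_ _ Vn)[cardX GX dX].
move=> /(_ _ Vm)[cardZ GZ dZ] bD bR.
have memO i : (i \in overlap n m) = (member i \in Zset W m).
  by rewrite inE cardZ eqxx.
have subO : @member n @: overlap n m \subset Zset W m.
  by apply/subsetP => _ /imsetP[i + ->]; rewrite memO.
have projE (u : {i : 'I_n | i \in overlap n m}) :
    zval exchange_of (@proj exchange_of n m u) = gain (member (sval u)).
  by case: u => i /= iO; rewrite nth_index // mem_enum -memO.
split.
- by rewrite inE; apply: le_trans dZ; apply: dsizeS.
- split=> [u v /= [] | | u]; last by rewrite projE.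
    move/(congr1 (nth x0 (enum (Zset W m)))).
    rewrite !nth_index ?mem_enum -?memO; try by case: (u); try by case: (v).
    by move/inj/val_inj.
  apply/subsetP => i; rewrite memO inE => iZ; apply: le_trans dZ.
  have := @dsizeS [set member i] (Zset W m).
  by rewrite sub1set /d {1}/total big_set1; apply.
- move=> i; rewrite inE -ltNge => di /=.
  rewrite (eq_bigr (fun u => gain (member (sval u)))) => [|u _]; last exact: projE.
  rewrite -(big_sub (overlap n m) (fun i => gain (member i))).
  rewrite -(total_member _ _ Vn).
  have iO : i \notin overlap n m.
    rewrite memO; apply/negP => iZ.
    have := @dsizeS [set member i] (Zset W m).
    rewrite sub1set /d {1}/total big_set1 => /(_ iZ).
    by move: di dZ; rewrite -/d; lra.
  (* Swapping the long member [i] for Z_m frees enough room in D. *)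
  set O := @member n @: overlap n m.
  pose S := (Xset W n :\ member i) :|: Zset W m.
  have SI : (Xset W n :\ member i) :&: Zset W m = O.
    apply/setP => x; rewrite !inE; apply/idP/imsetP => [|[j jO ->]].
      case/andP=> /andP[xi xX] xZ; move: xX xZ.
      rewrite -(member_im Vn) => /imsetP[j _ xE] xZ; exists j => //.
      by rewrite memO -xE.
    rewrite member_in // -memO jO !andbT.
    by apply: contraNneq iO => /inj <-.
  have cardS : #|S| = (n.-1 + m - #|overlap n m|)%N.
    have := cardsD1 (member i) (Xset W n); rewrite member_in // cardX add1n.
    by move/(congr1 predn) => /= ->; rewrite cardsU SI card_imset // cardZ.
  have totX f : total f (Xset W n) = f (member i) + total f (Xset W n :\ member i).
    by rewrite /total (big_setD1 (member i)) ?member_in.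
  have := totalU (@gain W) (Xset W n :\ member i) (Zset W m).
  have := totalU (@dsize W) (Xset W n :\ member i) (Zset W m).
  rewrite -/S SI -cardS.
  have := totX (@gain W); have := totX (@dsize W).
  have dO : 0 <= total (@dsize W) O by apply: sumr_ge0 => x _; apply: ltW.
  move=> dXE GXE dU GU.
  suff: total (@gain W) S <= Hw #|S| by move: GX GZ => /=; lra.
  by apply: bD; move: dX dZ di => /=; lra.
- move=> i i' ii'; rewrite inE -ltNge imsetU1 imset_set1 => dii y.
  rewrite in_setU in_set2 !negb_or => /andP[/andP[yi yi'] yO].
  have yZ : member y \notin Zset W m by rewrite -memO.
  (* The infeasible pair is larger than R, so Z_m fits in its place next to y. *)
  pose S := member y |: Zset W m.
  have tot f : total f S = f (member y) + total f (Zset W m).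
    by rewrite /total big_setU1.
  have cardS : #|S| = m.+1 by rewrite cardsU1 yZ cardZ.
  have := bD S; rewrite !tot GZ cardS; apply.
  have := @dsizeS (member y |: [set member i; member i']) (Xset W n).
  rewrite subUset subUset !sub1set !member_in // => /(_ isT).
  rewrite /d {1}/total big_setU1 /=; last first.
    by rewrite !inE (inj_eq inj) (inj_eq inj) negb_or yi yi'.
  by move: dii dX dZ; rewrite /d /total /=; lra.
Qed.

Lemma exchange_of_admissible : admissible Hw Hr exchange_of.
Proof. by split; [exact: exchange_X | exact: exchange_Z | exact: exchange_XZ]. Qed.

End FullToExchange.

Lemma full_to_exchange Hw Hr :
  full_witness_closure Hw Hr -> exchange_closure Hw Hr.
Proof.
case=> W W_ok; split; first exact: full_dominance W_ok.
(* An empty ground set leaves no vertices, and then any data is admissible. *)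
have [x0 _|ground0] := pickP (@predT (ground W)).
  by exists (exchange_of x0); apply: exchange_of_admissible.
have noS (S : {set ground W}) : #|S| = 0%N by apply: eq_card0 => x; have := ground0 x.
have noX n : ~~ vertex Hw n.
  apply/negP => Vn; case: W_ok => _ /(_ _ Vn)[]; rewrite noS => n0 _ _ _ _ _.
  by rewrite /vertex -n0 in Vn.
have noZ m : ~~ vertex Hr m.
  apply/negP => Vm; case: W_ok => _ _ /(_ _ Vm)[]; rewrite noS => m0 _ _ _ _.
  by rewrite /vertex -m0 in Vm.
have none n m : {i : 'I_n | i \in (set0 : {set 'I_n})} -> 'I_m.
  by case=> i iO; exfalso; rewrite inE in iO.
exists (ExchangeData (fun _ _ => 0) (fun _ => set0) (fun _ => set0)
  (fun _ _ => 0) none).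
by split=> [n|m|n m] V; rewrite ?(negPf (noX _)) ?(negPf (noZ _)) in V.
Qed.

(** * Target sequences with positive integer slopes *)

Section SlopeLists.
Local Open Scope nat_scope.

Definition psum (s : seq nat) (k : nat) : nat := sumn (take k s).

Definition list_vertex (s : seq nat) (n : nat) : bool :=
  (0 < n <= size s) && ((n == size s) || (nth 0 s n.-1 != nth 0 s n)).

Definition list_vertices (s : seq nat) : seq nat :=
  [seq n <- iota 1 (size s) | list_vertex s n].

(** The nonincreasing lists of length l with entries between 1 and B. *)
Fixpoint slope_lists (B l : nat) : seq (seq nat) :=
  if l is l'.+1 then
    flatten [seq [seq x :: s | s <- slope_lists x l'] | x <- iota 1 B]
  else [:: [::]].

Lemma psumS s k : psum s k.+1 = psum s k + nth 0 s k.
Proof.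
rewrite /psum; case: (ltnP k (size s)) => [ltk|lek].
  by rewrite (take_nth 0 ltk) sumn_rcons.
by rewrite !take_oversize ?nth_default ?addn0 // leqW.
Qed.

Lemma mem_slope_lists B s :
  path geq B s -> all (leq 1) s -> s \in slope_lists B (size s).
Proof.
elim: s B => [|x s IH] B //= /andP[xB xs] /andP[x_gt0 s_gt0].
apply/flattenP; exists [seq x :: t | t <- slope_lists x (size s)].
  by apply/mapP; exists x => //; rewrite mem_iota x_gt0.
by apply/map_f/IH.
Qed.

End SlopeLists.

Definition represents (H : target_seq) (s : seq nat) : Prop :=
  len H = size s /\ forall k, H k = (psum s k)%:R.

Lemma slope_represents H s n : represents H s -> (0 < n)%N ->
  slope H n = (nth 0%N s n.-1)%:R.
Proof.
case=> _ HE; case: n => // n _.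
by rewrite /slope /= !HE psumS natrD addrAC subrr add0r.
Qed.

Lemma vertex_represents H s n : represents H s -> vertex H n = list_vertex s n.
Proof.
move=> Hs; rewrite /vertex /list_vertex; case: n => // n.
by rewrite !(slope_represents Hs) // eqr_nat; case: Hs => ->.
Qed.

Lemma sum_vertices H s : represents H s ->
  (\sum_(n < (len H).+1 | vertex H n) n = sumn (list_vertices s))%N.
Proof.
move=> Hs; rewrite -(big_mkord (vertex H) id) /index_iota subn0 big_cons.
rewrite sumnE big_filter; case: (Hs) => -> _.
by apply: eq_bigl => n; apply: vertex_represents.
Qed.

Lemma slopes_in_represents B H : slopes_in B H ->
  exists2 s, s \in slope_lists B (len H) & represents H s.
Proof.
move=> slopes; pose f i := Num.trunc (slope H i.+1).
have fP i : (i < len H)%N -> (0 < f i <= B)%N /\ slope H i.+1 = (f i)%:R.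
  by move=> lti; have [j jB e] := slopes i.+1 lti; rewrite /f e natrK.
pose s := mkseq f (len H).
have HE k : H k = (psum s k)%:R.
  elim: k => [|k IH]; first by rewrite ext0 /psum take0.
  rewrite psumS natrD -IH; case: (ltnP k (len H)) => [ltk|lek].
    have [_ e] := fP k ltk.
    by rewrite nth_mkseq // -e /slope addrC subrK.
  by rewrite nth_default ?size_mkseq // addr0 ext_const.
exists s; last by split; rewrite ?size_mkseq.
rewrite -[X in slope_lists _ X](size_mkseq f); apply: mem_slope_lists; last first.
  by apply/allP => _ /mapP[i + ->]; rewrite mem_iota => /fP[/andP[]].
apply/(pathP 0%N) => -[|i]; rewrite size_mkseq => ltb.
  by rewrite nth_mkseq //; case: (fP _ ltb) => /andP[].
rewrite /= !nth_mkseq ?(ltnW ltb) //= -(ler_nat rat).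
have [[_ <-] [_ <-]] := (fP _ ltb, fP _ (ltnW ltb)).
exact: ext_concave.
Qed.

(** * Dominance and the linear closure as integer inequalities *)

Section IntegerConditions.
Local Open Scope nat_scope.

Definition dominatedb (h p : seq nat) : bool :=
  all (fun k => psum p k <= psum h k) (iota 0 (size p).+1).

(** The inequalities of [linear_closure] multiplied by n or n - 1, and a bound by
    a minimum split into a disjunction. *)
Definition linearb (h p : seq nat) : bool :=
  let r := nth 0 p 0 in let H := psum h in let K := psum p in
  all (fun n => all (fun m =>
    ((r < nth 0 h n.-1) ==>
       (n.-1 * H n + n * K m <= n * H (n.-1 + m)) &&
       ((3 <= n) ==> (H n + n * K m <= n * H m.+1))) &&
    ((3 <= n) && (K 2 + (n - 2) * H 1 < H n) ==>
       (n * K m + H n <= n * H m.+1) ||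
       (n.-1 * K m + H n <= n.-1 * H m.+1 + r)))
    (iota 0 (size p).+1)) (list_vertices h).

Lemma dominance_list Hw Hr h p : represents Hw h -> represents Hr p ->
  dominance Hw Hr -> dominatedb h p.
Proof.
move=> [_ wE] [szp rE] domHH; apply/allP => k; rewrite mem_iota add0n ltnS /= -szp.
by move/domHH; rewrite wE rE ler_nat.
Qed.

Lemma linear_closure_list Hw Hr h p : represents Hw h -> represents Hr p ->
  linear_closure Hw Hr -> linearb h p.
Proof.
move=> Hh Hp [_ lin]; have [_ wE] := Hh; have [szp rE] := Hp.
have rhoE : rho1 Hr = (nth 0 p 0)%:R%R by apply: slope_represents.
apply/allP => n; rewrite mem_filter -(vertex_represents _ Hh) => /andP[Vn _].
apply/allP => m; rewrite mem_iota add0n ltnS /= -szp => /lin[lin1 lin2].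
have n_gt0 : 0 < n by case/andP: Vn => /andP[].
have nR : (0 < n%:R :> rat)%R by rewrite ltr0n.
have nN0 : (n%:R != 0 :> rat)%R by rewrite gt_eqF.
apply/andP; split; apply/implyP.
  rewrite -(ltr_nat rat) -(slope_represents Hh) // -rhoE.
  move=> /(lin1 _ Vn)[le1 le2]; apply/andP; split.
    move: le1; rewrite -(ler_pM2l nR) -(ler_nat rat) !natrD !natrM -!wE -rE.
    by rewrite mulrDr mulrA mulrCA divff // mulr1.
  apply/implyP => /le2; rewrite -(ler_pM2l nR) -(ler_nat rat) natrD !natrM.
  by rewrite -!wE -rE mulrDr mulrA divff // mul1r.
case/andP => n3 tight; have := lin2 _ Vn n3.
have n1R : (0 < n.-1%:R :> rat)%R by rewrite ltr0n; case: (n) n3 => [|[]].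
have n1N0 : (n.-1%:R != 0 :> rat)%R by rewrite gt_eqF.
rewrite ltrBrDr !wE !rE rhoE -natrM -natrD ltr_nat => /(_ tight).
rewrite -lerBrDl ge_min => /orP[] le3; apply/orP; [left | right]; move: le3;
  by rewrite ler_pdivrMr // -(ler_nat rat) !natrD !natrM; lra.
Qed.

End IntegerConditions.

(** * Checking a full witness by enumeration *)

Section Certificates.
Local Open Scope nat_scope.

(** An item is a pair of six times its gain and its size: the gains in use are
    halves and thirds of integers. The sets X_n and Z_m list positions in
    [items]. *)
Record certificate := Certificate {
  items : seq (nat * nat);
  cR : nat;
  cD : nat;
  cX : nat -> seq nat;
  cZ : nat -> seq nat }.

(** Whether every way to extend k chosen items of total gain g by items of l
    within the remaining capacity respects the bound H; the recursion visits
    only sets that fit. *)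
Fixpoint fits (H : nat -> nat) (cap k g : nat) (l : seq (nat * nat)) : bool :=
  if l is (a, d) :: l' then
    fits H cap k g l' && ((d <= cap) ==> fits H (cap - d) k.+1 (g + a) l')
  else g <= H k.

Lemma fits_mask H cap k g l : fits H cap k g l ->
  forall m, size m = size l -> sumn (unzip2 (mask m l)) <= cap ->
  g + sumn (unzip1 (mask m l)) <= H (k + count id m).
Proof.
elim: l cap k g => [|[a d] l IH] cap k g /= => [gH [] // _ _|].
  by rewrite !addn0.
case/andP => fits0 /implyP fits1 [|[] m] //= [szm].
  move=> le_cap; have le_d := leq_trans (leq_addr _ _) le_cap.
  rewrite addnA -addSnnS; apply: (IH _ _ _ (fits1 le_d)) => //.
  by rewrite leq_subRL.
by rewrite add0n; apply: IH.
Qed.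

Definition selection_ok (l : seq (nat * nat)) (cap : nat) (H : nat -> nat)
    (n : nat) (s : seq nat) : bool :=
  [&& uniq s, all (fun i => i < size l) s, size s == n,
      sumn [seq (nth (0, 0) l i).1 | i <- s] == H n
    & sumn [seq (nth (0, 0) l i).2 | i <- s] <= cap].

Definition certifies (h p : seq nat) (c : certificate) : bool :=
  let H k := 6 * psum h k in let K k := 6 * psum p k in
  [&& size (items c) <= sumn (list_vertices h) + sumn (list_vertices p),
      all (fun x => 0 < x.2) (items c), cR c < cD c,
      all (fun n => selection_ok (items c) (cD c) H n (cX c n)) (list_vertices h),
      all (fun m => selection_ok (items c) (cR c) K m (cZ c m)) (list_vertices p),
      fits H (cD c) 0 0 (items c)
    & fits K (cR c) 0 0 (items c)].

End Certificates.

Section Soundness.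
Variables (l : seq (nat * nat)).
Let item (i : nat) := nth (0, 0)%N l i.

Lemma sum_selection N (F : nat -> nat) (s : seq nat) :
    uniq s -> all (fun i => i < N)%N s ->
  (\sum_(i in [set i : 'I_N | val i \in s]) F i = sumn [seq F i | i <- s])%N.
Proof.
move=> s_uniq s_lt; pose t : seq 'I_N := pmap insub s.
have tE : map val t = s.
  rewrite /t (pmap_filter (insubK _)); apply/all_filterP.
  by apply: sub_all s_lt => i lti /=; rewrite isSome_insub.
have t_uniq : uniq t by rewrite -(map_inj_uniq val_inj) tE.
rewrite sumnE -tE !big_map big_uniq //=.
by apply: eq_bigl => i; rewrite inE (mem_map val_inj).
Qed.

Lemma sum_mask (S : {set 'I_(size l)}) (f : nat * nat -> nat) :
  let m := [seq i \in S | i <- enum 'I_(size l)] in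
  (\sum_(i in S) f (item i) = sumn (map f (mask m l)))%N.
Proof.
move=> m; rewrite sumnE big_map big_mask /=.
apply: eq_big => i; last by rewrite (tnth_nth (0, 0)%N).
by rewrite andbT (nth_map i) ?size_enum_ord // nth_ord_enum.
Qed.

Lemma fits_sets (H : nat -> nat) cap : fits H cap 0 0 l ->
  forall S : {set 'I_(size l)}, (\sum_(i in S) (item i).2 <= cap)%N ->
  (\sum_(i in S) (item i).1 <= H #|S|)%N.
Proof.
move=> fitsH S; rewrite !(sum_mask S) => le_cap.
have := fits_mask fitsH _ le_cap; rewrite size_map size_enum_ord => /(_ erefl).
by rewrite !add0n -[in X in (_ <= H X)%N]sum1_count big_map big_enum_cond sum1_card.
Qed.
End Soundness.

Definition witness_of (c : certificate) : full_witness_data :=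
  @FullWitnessData 'I_(size (items c))
    (fun i => (nth (0, 0)%N (items c) i).1%:R / 6%:R)
    (fun i => (nth (0, 0)%N (items c) i).2%:R)
    (cR c)%:R (cD c)%:R
    (fun n => [set i | val i \in cX c n])
    (fun m => [set i | val i \in cZ c m]).

Lemma certificate_sound Hw Hr h p c : represents Hw h -> represents Hr p ->
  certifies h p c -> full_witness_closure Hw Hr.
Proof.
move=> Hh Hp /and5P[leN d_gt0 RD okX /and3P[okZ fitD fitR]].
exists (witness_of c).
have gainE (S : {set 'I_(size (items c))}) :
    total (@gain (witness_of c)) S
      = (\sum_(i in S) (nth (0, 0)%N (items c) i).1)%N%:R / 6%:R.
  by rewrite natr_sum mulr_suml.
have sizeE (S : {set 'I_(size (items c))}) :
    total (@dsize (witness_of c)) S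
      = (\sum_(i in S) (nth (0, 0)%N (items c) i).2)%N%:R.
  by rewrite natr_sum.
have selectP H s cap (sel : nat -> seq nat) : represents H s ->
    all (fun n => selection_ok (items c) cap (fun k => (6 * psum s k)%N) n (sel n))
      (list_vertices s) ->
    forall n, vertex H n ->
    let S := [set i : 'I_(size (items c)) | val i \in sel n] in
    [/\ #|S| = n, total (@gain (witness_of c)) S = H n
      & total (@dsize (witness_of c)) S <= cap%:R].
  move=> Hs /allP ok n Vn S.
  have /ok : n \in list_vertices s.
    rewrite mem_filter -(vertex_represents _ Hs) Vn mem_iota add1n ltnS.
    by case: Hs Vn => <- _ /andP[].
  case/and5P => s_uniq s_lt /eqP sz /eqP sumg sumd.
  rewrite -sum1_card gainE sizeE.
  rewrite (sum_selection (fun=> 1%N)) //.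
  rewrite (sum_selection (fun i => (nth (0, 0)%N (items c) i).1)) //.
  rewrite (sum_selection (fun i => (nth (0, 0)%N (items c) i).2)) // ler_nat.
  split=> //; first by rewrite sumnE big_map sum1_size.
  by rewrite sumg natrM mulrAC divff // mul1r; case: Hs => _ ->.
have boundP H s cap : represents H s ->
    fits (fun k => (6 * psum s k)%N) cap 0 0 (items c) ->
    forall S : {set ground (witness_of c)},
    total (@dsize (witness_of c)) S <= cap%:R ->
    total (@gain (witness_of c)) S <= H #|S|.
  move=> [_ HE] fitH S; rewrite gainE sizeE ler_nat => /(fits_sets fitH).
  by rewrite HE ler_pdivrMr // -natrM ler_nat mulnC.
split.
- split=> [|i|i|]; rewrite /= ?ler0n ?ltr_nat ?divr_ge0 ?ler0n //.
    by rewrite card_ord /Nstar (sum_vertices Hh) (sum_vertices Hp).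
  by rewrite ltr0n; apply: (allP d_gt0); apply: mem_nth.
- exact: selectP Hh okX.
- exact: selectP Hp okZ.
- exact: boundP Hh fitD.
- exact: boundP Hp fitR.
Qed.

(** * The witnesses *)

Section Constructions.
Local Open Scope nat_scope.

(** Short items of values q and size 6 fill R exactly; an extra item, if any,
    fills R alone and serves as Z_1, and the other Z_m are the first m short
    items. X_n consists of the first k_n short items and of n - k_n equal long
    items of its own, which share what is left of Hw n and of D (k_1 = 0). The
    divisions are exact for the parameters used below. *)
Definition layered (h q : seq nat) (extra : seq nat) (D k2 k3 : nat) : certificate :=
  let b := size q in
  let k := nth 0 [:: 0; 0; k2; k3] in
  let long n := if list_vertex h n then
      nseq (n - k n) (6 %/ (n - k n) * (psum h n - psum q (k n)),
                      (D - 6 * k n) %/ (n - k n))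
    else [::] in
  let short := [seq (6 * x, 6) | x <- q] ++ [seq (6 * x, 6 * b) | x <- extra] in
  let start n := size short + sumn [seq size (long i) | i <- iota 1 n.-1] in
  Certificate (short ++ long 1 ++ long 2 ++ long 3) (6 * b) D
    (fun n => iota 0 (k n) ++ iota (start n) (n - k n))
    (fun m => if (m == 1) && (extra != [::]) then [:: b] else iota 0 m).

(** In the first four candidates the short items are the slopes of Hr, and D
    exceeds three times R, so that no long item fits R. They differ in how many
    short items X_2 and X_3 contain: more of them when the slopes of Hw at 2 and
    3 are small compared with those of Hr, none when those slopes exceed rho_1.

    The fifth serves pairs such as h = (5, 4, 3), rho = (5, 2, 2). There Hr 2
    reaches h_2 + h_3, so two members of X_3 may be short, but rho_2 < h_3, so
    these cannot be worth rho_1 and rho_2. The short items take the values h_2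
    and h_3 instead, followed by what completes them to Hr 3 and then by the
    slopes of Hr, and an extra item of value rho_1 provides Z_1. The capacity
    D = R + 15 lets two short items accompany the extra one, but not three.

    The last two are for h = (6, 3, 3), rho = (6, 2, 2), where X_3 and Z_3 each
    consist of three equal items, and for h = (6, 4, 4), rho = (6, 3, 2), where
    X_3 = {6, 4, 4}, Z_2 = {4, 5} and Z_3 = {4, 4, 3}. *)
Definition candidates (h p : seq nat) : seq certificate :=
  let D := 6 * (3 * size p).+1 in
  let h2 := nth 0 h 1 in let h3 := nth 0 h 2 in
  let q := [:: h2, h3, psum p 3 - (h2 + h3) & drop 3 p] in
  [:: layered h p [::] D 1 2; layered h p [::] D 0 1;
      layered h p [::] D 0 0; layered h p [::] D 1 1;
      layered h q [:: nth 0 p 0] (6 * size p + 15) 1 2;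
      Certificate [:: (36, 12); (24, 5); (24, 5); (24, 5);
                      (36, 12); (20, 4); (20, 4); (20, 4)] 12 15
        (nth [::] [:: [::]; [:: 0]; [::]; [:: 1; 2; 3]])
        (nth [::] [:: [::]; [:: 4]; [::]; [:: 5; 6; 7]]);
      Certificate [:: (36, 9); (24, 2); (24, 2); (36, 8); (30, 6); (18, 4)] 8 13
        (nth [::] [:: [::]; [:: 0]; [::]; [:: 0; 1; 2]])
        (nth [::] [:: [::]; [:: 3]; [:: 1; 4]; [:: 1; 2; 5]])].

Definition all_certified (B M : nat) : bool :=
  all (fun h => all (fun b => all (fun p =>
      dominatedb h p && linearb h p ==> has (certifies h p) (candidates h p))
    (slope_lists B b)) (iota 0 M.+1)) (slope_lists B 3).

Lemma all_certified_6_3 : all_certified 6 3.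
Proof.
(* Under call by need a test stops at its first failure, which keeps the
   enumeration small. *)
by lazy.
Qed.

Lemma all_certified_4_4 : all_certified 4 4.
Proof. by lazy. Qed.

End Constructions.

Lemma linear_to_full B M Hw Hr : all_certified B M -> dom B M Hw Hr ->
  linear_closure Hw Hr -> full_witness_closure Hw Hr.
Proof.
move=> /allP cert [lenw lenr /slopes_in_represents[h hB Hh]].
move=> /slopes_in_represents[p pB Hp] domHH lin.
rewrite lenw in hB.
have := allP (cert h hB) (len Hr); rewrite mem_iota add0n ltnS => /(_ lenr).
move/allP/(_ p pB); rewrite (dominance_list Hh Hp) // (linear_closure_list Hh Hp) //.
pose c0 := Certificate [::] 0 0 (fun=> [::]) (fun=> [::]).
by rewrite implyTb => /(has_nthP c0)[i _]; apply: certificate_sound.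
Qed.

Lemma dom_agree B M : all_certified B M -> classes_agree_on (dom B M).
Proof.
move=> cert Hw Hr D.
have FE := @full_to_exchange Hw Hr.
have EL : exchange_closure Hw Hr -> linear_closure Hw Hr.
  by case=> domHH [W W_ok]; apply: exchange_to_linear W_ok domHH.
have LF := linear_to_full cert D.
by split; split; auto.
Qed.

Lemma agree_sub (D D' : target_seq -> target_seq -> Prop) :
  (forall Hw Hr, D' Hw Hr -> D Hw Hr) -> classes_agree_on D -> classes_agree_on D'.
Proof. by move=> sub agree Hw Hr /sub/agree. Qed.

Lemma dom_widen B B' M Hw Hr : (B <= B')%N -> dom B M Hw Hr -> dom B' M Hw Hr.
Proof.
move=> leB [lw lr sw sr dd]; split=> // n /[dup] => [/sw|/sr] [j /andP[j0 jB] e] _.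
  by exists j; rewrite // j0 (leq_trans jB).
by exists j; rewrite // j0 (leq_trans jB).
Qed.

Theorem propositionB1 :
  [/\ classes_agree_on (dom 5 3),
      classes_agree_on (dom 6 3)
    & classes_agree_on (dom 4 4)] /\
  [/\ classes_agree_on (fdom 5 3),
      classes_agree_on (fdom 6 3)
    & classes_agree_on (fdom 4 4)].
Proof.
have agree63 := dom_agree all_certified_6_3.
have agree44 := dom_agree all_certified_4_4.
have agree53 : classes_agree_on (dom 5 3).
  by apply: agree_sub agree63 => Hw Hr; apply: dom_widen.
by split; split=> //; [apply: agree_sub agree53 | apply: agree_sub agree63
  | apply: agree_sub agree44] => Hw Hr [].
Qed.
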